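(* Let $X,Y$ be real Banach spaces, $A\subseteq X$ a nonempty closed convex set, $C\subseteq Y$ a closed convex cone with nonempty interior, and $F:X\to Y$ a continuous linear map with $F(X)\cap\operatorname{int}C\neq\emptyset$. Let $\theta$ be the associated merit function, assumed to satisfy $\theta(x)<+\infty$ for all $x\in X$, let $E_w$ be the weakly efficient solution set, and let $\widehat A=X\setminus(A+\operatorname{int}C_X)$ with $C_X=F^{-1}(C)$. Consider the following statements: (i) There exists $\tau>0$ such that $d(x,E_w)\le\tau\,\theta(x)$ for all $x\in A$. (ii) There exists $\kappa>0$ such that $d_{A\cap\widehat A}(x)\le\kappa\max\{d_A(x),d_{\widehat A}(x)\}$ for all $x\in X$. (iii) There exists $\tau>0$ such that $d(x,E_w)\le\tau\,d_{\widehat A}(x)$ for all $x\in A$. (iv) There exist $\alpha>0$ and $\beta\in(0,1)$ such that for every $x\in A$ there is $y\in A$ with $\|x-y\|\le\alpha\,\theta(x)$ and $\theta(y)\le\beta\,\theta(x)$. (v) There exists $\kappa>0$ such that $d(x+e,E_w)\le\kappa(\theta(x)+\|e\|)$ for all $x\in A$ and all $e\in X$. (vi) There exists $\gamma>0$ such that $d(x,E_w)\le\gamma\bigl(\max\{\theta(x),0\}+d_A(x)\bigr)$ for all $x\in X$. (vii) There exists $\kappa>0$ such that $d(x,E_w)\le\kappa\,\zeta(x)$ for all $x\in X$, where $\zeta(x):=\inf_{a\in A}\bigl(\theta(a)+\|x-a\|\bigr)$. (viii) There exists $c>0$ such that for each $x\in A\setminus E_w$ there is $y\in A$ with $y\neq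 x$ and $\theta(y)\le\theta(x)-c\|x-y\|$. (ix) There exists $\gamma>0$ such that $m(x)\ge\gamma$ for all $x\in A\setminus E_w$, where $m(x):=\sup\bigl\{\frac{\theta(x)-\theta(y)}{\|x-y\|}: y\in A,\ \theta(y)<\theta(x)\bigr\}\in[0,+\infty]$. (x) There exists $c>0$ such that $d\bigl(F(x),\operatorname{WMin}(F(A),C)\bigr)\le c\,\theta(x)$ for all $x\in A$. (xi) $\displaystyle\liminf_{x\xrightarrow{A}E_w,\ x\notin E_w}\frac{d_{\widehat A}(x)}{d(x,E_w)}>0$, where $x\xrightarrow{A}E_w$ means $x\in A$ and $d(x,E_w)\to0$. (xii) There exist $t_0>0$ and $\beta>0$ such that $d_H(\Phi(t),E_w)\le\beta t$ for all $t\in[0,t_0]$. (xiii) There exist $\kappa>0$ and an open set $U\supseteq E_w$ such that $d(x,\Phi(0))\le\kappa\,d(0,\Phi^{-1}(x))$ for all $x\in U\cap A$. Then the following hold: 1. Statements (i)--(ix) are equivalent, and (i) $\Rightarrow$ (x), (iii) $\Rightarrow$ (xi), (i) $\Rightarrow$ (xii), (i) $\Rightarrow$ (xiii). 2. If there exists $\mu>0$ such that $\|F(z)\|\ge\mu\|z\|$ for all $z\in A-A$, then (x) $\Rightarrow$ (i). 3. If $A$ is bounded, then (xii) $\Rightarrow$ (i). 4. If $A$ is compact, then (xi) $\Rightarrow$ (iii) and (xiii) $\Rightarrow$ (i).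
   Context: For a set $D$, $d(x,D)=d_D(x)=\inf_{y\in D}\|x-y\|$, with $d_\emptyset\equiv+\infty$. For nonempty sets $Q,D$, the Hausdorff distance is $d_H(Q,D)=\max\{\sup_{x\in Q}d(x,D),\ \sup_{x\in D}d(x,Q)\}$. The oriented distance function is $\Delta_D(y)=d_D(y)-d_{Y\setminus D}(y)$ with conventions $\Delta_\emptyset\equiv+\infty$, $\Delta_Y\equiv-\infty$. $C^+=\{y^*\in Y^*:\langle y^*,c\rangle\ge 0\ \forall c\in C\}$, $S(C^+)=\{y^*\in C^+:\|y^*\|=1\}$. The merit function is $$\theta(x)=\sup_{a\in A}\bigl(-\Delta_C(F(x)-F(a))\bigr)=\sup_{a\in A}\inf_{y^*\in S(C^+)}\langle y^*,F(x)-F(a)\rangle .$$ The weakly efficient solution set is $E_w=\{\bar x\in A: F(\bar x)\notin F(A)+\operatorname{int}C\}$, and $\operatorname{WMin}(F(A),C)=\{b\in F(A): b\notin F(A)+\operatorname{int}C\}$. The set-valued map $\Phi:[0,+\infty)\rightrightarrows A$ is $\Phi(t)=\{x\in A:\theta(x)\le t\}$, and $\Phi^{-1}(x)=\{t\ge0: x\in\Phi(t)\}$. It is known that $\theta\ge0$ on $A$ and that, for $x\in A$, $\theta(x)=0$ if and only if $x\in E_w$; also $E_w=A\cap\widehat A$. *)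

(* Defs.v *)
From HB Require Import structures.
From mathcomp Require Import all_boot all_order all_algebra.
From mathcomp Require Import all_classical all_reals all_analysis.

Set Implicit Arguments.
Unset Strict Implicit.
Unset Printing Implicit Defensive.

Import Order.TTheory GRing.Theory Num.Theory.
Import numFieldNormedType.Exports.

Local Open Scope classical_set_scope.
Local Open Scope ring_scope.
Local Open Scope ereal_scope.

(* Every distance, supremum and infimum is taken in [\bar R]: the infimum of
   the empty set is [+oo] and its supremum is [-oo]. *)

Definition set_add (V : zmodType) (P Q : set V) : set V :=
  [set (p + q)%R | p in P & q in Q].

Definition set_sub (V : zmodType) (P Q : set V) : set V :=
  [set (p - q)%R | p in P & q in Q].

Definition cone (R : realType) (V : lmodType R) (C : set V) : Prop :=
  forall (t : R) (c : V), (0 <= t)%R -> C c -> C (t *: c)%R.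

Definition dist_set (R : realType) (V : normedModType R) (D : set V) (x : V) :
  \bar R := ereal_inf [set `|x - y|%:E | y in D].

(* The usual definition concerns nonempty sets. Here the distance between a
   nonempty set and the empty set is [+oo]. *)
Definition hausdorff_dist (R : realType) (V : normedModType R) (Q D : set V) :
    \bar R :=
  maxe (ereal_sup [set dist_set D x | x in Q])
       (ereal_sup [set dist_set Q x | x in D]).

(* [dist_set set0] is [+oo], so [oriented_dist set0] is [+oo] and
   [oriented_dist setT] is [-oo]. *)
Definition oriented_dist (R : realType) (V : normedModType R) (D : set V)
  (y : V) : \bar R := dist_set D y - dist_set (~` D) y.

Definition wmin (R : realType) (V : normedModType R) (B C : set V) : set V :=
  B `\` set_add B C°.

Section linear_vector_optimization.
Context (R : realType) (X Y : normedModType R).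
Context (A : set X) (C : set Y) (F : X -> Y).

Definition merit (x : X) : \bar R :=
  ereal_sup [set - oriented_dist C (F x - F a)%R | a in A].

Definition weakly_efficient : set X :=
  [set x | A x /\ ~ set_add (F @` A) C° (F x)].

Definition hatA : set X := ~` set_add A (F @^-1` C)°.

Definition Phi (t : R) : set X := [set x | A x /\ merit x <= t%:E].

Definition Phi_inv (x : X) : set R := [set t | (0 <= t)%R /\ Phi t x].

Definition zeta (x : X) : \bar R :=
  ereal_inf [set merit a + `|x - a|%:E | a in A].

(* The supremum is taken in [[0, +oo]], hence the [maxe 0]. *)
Definition merit_slope (x : X) : \bar R :=
  maxe 0 (ereal_sup [set (merit x - merit y) / `|x - y|%:E
                    | y in [set y | A y /\ merit y < merit x]]).

(* The filter of "x in A, x not in E_w and d(x, E_w) -> 0". If no x in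
   A \ E_w is arbitrarily close to E_w it is improper, and the lower limit
   along it is [+oo]. *)
Definition approach_weakly_efficient : set_system X :=
  within (A `\` weakly_efficient)
    (filter_from [set e : R | (0 < e)%R]
       (fun e => [set x | dist_set weakly_efficient x < e%:E])).

Definition merit_error_bound : Prop :=
  exists2 tau : R, (0 < tau)%R & forall x, A x ->
    dist_set weakly_efficient x <= tau%:E * merit x.

Definition linear_regularity : Prop :=
  exists2 kappa : R, (0 < kappa)%R & forall x,
    dist_set (A `&` hatA) x <=
      kappa%:E * maxe (dist_set A x) (dist_set hatA x).

Definition hatA_error_bound : Prop :=
  exists2 tau : R, (0 < tau)%R & forall x, A x ->
    dist_set weakly_efficient x <= tau%:E * dist_set hatA x.

Definition merit_contraction : Prop :=
  exists alpha beta : R, [/\ (0 < alpha)%R, (0 < beta < 1)%R &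
    forall x, A x -> exists y, [/\ A y, `|x - y|%:E <= alpha%:E * merit x &
                                   merit y <= beta%:E * merit x]].

Definition perturbed_error_bound : Prop :=
  exists2 kappa : R, (0 < kappa)%R & forall x e, A x ->
    dist_set weakly_efficient (x + e)%R <= kappa%:E * (merit x + `|e|%:E).

Definition ambient_error_bound : Prop :=
  exists2 gamma : R, (0 < gamma)%R & forall x,
    dist_set weakly_efficient x <=
      gamma%:E * (maxe (merit x) 0 + dist_set A x).

Definition zeta_error_bound : Prop :=
  exists2 kappa : R, (0 < kappa)%R & forall x,
    dist_set weakly_efficient x <= kappa%:E * zeta x.

Definition merit_decrease : Prop :=
  exists2 c : R, (0 < c)%R & forall x, (A `\` weakly_efficient) x ->
    exists y, [/\ A y, y <> x & merit y <= merit x - c%:E * `|x - y|%:E].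

Definition merit_slope_bound : Prop :=
  exists2 gamma : R, (0 < gamma)%R & forall x, (A `\` weakly_efficient) x ->
    gamma%:E <= merit_slope x.

Definition image_error_bound : Prop :=
  exists2 c : R, (0 < c)%R & forall x, A x ->
    dist_set (wmin (F @` A) C) (F x) <= c%:E * merit x.

Definition positive_liminf_ratio : Prop :=
  0 < limf_einf (fun x => dist_set hatA x / dist_set weakly_efficient x)
        approach_weakly_efficient.

Definition Phi_hausdorff_calm : Prop :=
  exists t0 beta : R, [/\ (0 < t0)%R, (0 < beta)%R &
    forall t, (0 <= t <= t0)%R ->
      hausdorff_dist (Phi t) weakly_efficient <= (beta * t)%:E].

Definition Phi_metric_subregular : Prop :=
  exists (kappa : R) (U : set X),
    [/\ (0 < kappa)%R, open U, weakly_efficient `<=` U &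
      forall x, (U `&` A) x ->
        dist_set (Phi 0) x <= kappa%:E * dist_set (Phi_inv x) 0%R].

End linear_vector_optimization.

(* Main.v *)
(* On A the merit function theta is Lipschitz, vanishes exactly on E_w, and is
   comparable on the whole space (after truncation at 0) to the distance to hatA:
   if F (x - a) is at distance t from the complement of C then the ball around x
   of radius t / L misses hatA, where L bounds the norm of F; conversely, moving
   x by a multiple of -k, with F k interior to C, reaches hatA after a length of
   order theta x. Hence every distance estimate among the statements follows from
   the triangle inequality and (i). Statements (iv), (viii) and (ix) give (i) by
   Ekeland-Caristi descent along theta in the complete set A.

   For the partial converses, distance to the complement of C is superadditive on
   the interior of C, so a point a nearly maximizing it at F x - F a has a small
   value of theta: the infimum of theta over A is 0. Thus E_w is nonempty under
   (xii) and for compact A, and away from E_w both theta and d(., E_w) are then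
   bounded, the former from below. *)
Require Import Defs.
From HB Require Import structures.
From mathcomp Require Import all_boot all_order all_algebra.
From mathcomp Require Import lra.
From mathcomp Require Import all_classical all_reals all_analysis.
Import Order.TTheory GRing.Theory Num.Theory.
Import numFieldNormedType.Exports.
Local Open Scope classical_set_scope.
Local Open Scope ring_scope.

Set Implicit Arguments.
Unset Strict Implicit.
Unset Printing Implicit Defensive.

(** * Descent along a function in a closed subset of a complete space *)

(** The relation [f y + c * |z - y| <= f z] is a partial order on [A]. A greedy descending sequence
    converges to a point with no further descent, which must lie in [E]; summing the steps bounds
    its distance from [x]. *)
Lemma caristi (R : realType) (X : completeNormedModType R) (A E : set X)
    (f : X -> R) (c : R) :
  closed A -> continuous f -> (forall x, A x -> 0 <= f x) -> 0 < c ->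
  (forall x, A x -> ~ E x ->
     exists y, [/\ A y, y <> x & f y + c * `|x - y| <= f x]) ->
  forall x, A x -> exists y, [/\ A y, E y & c * `|x - y| <= f x].
Proof.
move=> Acl fc f0 c0 dec x Ax.
(* Each step nearly minimizes [f] over [S], so the limit [l] has [S l = {l}]. *)
pose S z := [set y | A y /\ f y + c * `|z - y| <= f z].
have SS z y w : S z y -> S y w -> S z w.
  move=> [_ h1] [Aw h2]; split=> //.
  have := ler_wpM2l (ltW c0) (ler_distD y z w).
  by rewrite mulrDr; lra.
have Sxx z : A z -> S z z by move=> Az; split=> //; rewrite subrr normr0; lra.
have Scl z : closed (S z).
  rewrite (_ : S z = A `&` (fun y => f y + c * `|z - y|) @^-1` [set r | r <= f z])//.
  apply: closedI => //; apply: closed_comp; last exact: closed_le.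
  move=> y _; apply: cvgD; first exact: fc.
  by apply: cvgM; [exact: cvg_cst|apply: cvg_norm; apply: cvgB; [exact: cvg_cst|exact: cvg_id]].
(* Membership in [A] is a premise inside the sigma type, so that [u] is defined by plain recursion
   and [uA] is proved afterwards. *)
have next (n : nat) z : {y | A z -> S z y /\ forall w, S z w -> f y <= f w + n.+1%:R^-1}.
  apply: cid; case: (pselect (A z)) => Az; last by exists z.
  have hi : has_inf (f @` S z).
    split; first by exists (f z); exists z => //; exact: Sxx.
    by exists 0 => _ [y [Ay _] <-]; exact: f0.
  have n0 : 0 < n.+1%:R^-1 :> R by rewrite invr_gt0.
  have [_ [y Szy <-] yinf] := inf_adherent n0 hi.
  exists y => _; split=> // w Szw.
  apply: (le_trans (ltW yinf)); rewrite lerD2r.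
  by apply: ge_inf; [case: hi|exists w].
pose u := fix u n := if n is k.+1 then sval (next k (u k)) else x.
have uA n : A (u n).
  by elim: n => [//|n ih] /=; case: (next n (u n)) => y /= /(_ ih)[[]].
have uS n : S (u n) (u n.+1).
  by rewrite /=; case: (next n (u n)) => y /= /(_ (uA n))[].
have umin n w : S (u n) w -> f (u n.+1) <= f w + n.+1%:R^-1.
  by rewrite /=; case: (next n (u n)) => y /= /(_ (uA n))[_ /(_ w)].
have uSm n m : (n <= m)%N -> S (u n) (u m).
  elim: m => [|m ih]; first by rewrite leqn0 => /eqP ->; exact: Sxx.
  rewrite leq_eqVlt => /orP[/eqP ->|]; first exact: Sxx.
  by rewrite ltnS => /ih h; exact: (SS _ (u m)).
have ucvg : cvg (u @ \oo).
  apply/cauchy_cvgP; apply: cauchy_exP => e e0.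
  have hi : has_inf (range (f \o u)).
    split; first by exists (f (u 0%N)), 0%N.
    by exists 0 => _ [n _ <-]; exact: f0.
  (* Once [f (u N)] is within [c * e] of the infimum along [u], every later term stays within [e] of
     [u N]. *)
  have [_ [N _ <-] Ninf] := inf_adherent (mulr_gt0 c0 e0) hi.
  exists (u N); exists N => // m /= Nm.
  have [_ h] := uSm _ _ Nm.
  have : inf (range (f \o u)) <= f (u m) by apply: ge_inf; [case: hi|exists m].
  rewrite -ball_normE /ball_/= => h2.
  by rewrite -(ltr_pM2l c0) /=; move: Ninf h h2 => /=; lra.
pose l := lim (u @ \oo).
have Sl n : S (u n) l.
  apply: (closed_cvg (S (u n))) ucvg => //; exists n => // m /= nm; exact: uSm.
have [Al lx] := Sl 0%N.
exists l; split => //; last first.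
  by move: lx (f0 _ Al) => /=; lra.
apply: contrapT => nE.
have [y [Ay yl hy]] := dec _ Al nE.
(* Moving from [l] to [y] would strictly decrease [f], yet [y] lies in every [S (u n)], over which
   [u n.+1] is nearly minimal. *)
suff fly : f l <= f y.
  have : 0 < c * `|l - y| by rewrite mulr_gt0 // normr_gt0 subr_eq0 eq_sym; apply/eqP.
  by lra.
apply/ler_addgt0Pr => e e0.
have [n ne] : exists n, n.+1%:R^-1 < e.
  by have [k hk] := ltr_add_invr e0; exists k; move: hk; rewrite add0r.
have h1 : f (u n.+1) <= f y + n.+1%:R^-1.
  by apply: umin; exact: (SS _ _ _ (Sl n) (conj Ay hy)).
have h2 : f l + c * `|u n.+1 - l| <= f (u n.+1) by have [] := Sl n.+1.
have h3 : 0 <= c * `|u n.+1 - l| by rewrite mulr_ge0 // ltW.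
by move: h1 h2 h3 ne; move: (u n.+1) n.+1%:R^-1 => z r; lra.
Qed.

(** * Distances to a set and to its complement *)

Section dist_set.
Context (R : realType) (V : normedModType R).
Implicit Types (D : set V) (x y : V) (r : R).

Lemma dist_set_ge0 D x : (0 <= dist_set D x)%E.
Proof. by apply: le_ereal_inf_tmp => _ [y _ <-]; rewrite lee_fin. Qed.

Lemma dist_set_le D x y : D y -> (dist_set D x <= `|x - y|%:E)%E.
Proof. by move=> Dy; apply: ereal_inf_lbound; exists y. Qed.

Lemma dist_set_geP D x r :
  (r%:E <= dist_set D x)%E <-> forall y, D y -> r <= `|x - y|.
Proof.
split=> [rD y Dy|rD].
  by rewrite -lee_fin; exact: (le_trans rD (dist_set_le _ Dy)).
by apply: le_ereal_inf_tmp => _ [y Dy <-]; rewrite lee_fin; exact: rD.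
Qed.

Lemma dist_set_ltP D x r :
  (dist_set D x < r%:E)%E <-> exists2 y, D y & `|x - y| < r.
Proof.
split=> [/ereal_inf_lt[_ [y Dy <-]]|[y Dy]].
  by rewrite lte_fin; exists y.
by rewrite -lte_fin; apply: le_lt_trans; exact: dist_set_le.
Qed.

Lemma dist_set_triangle D x y : (dist_set D x <= dist_set D y + `|x - y|%:E)%E.
Proof.
rewrite -leeBlDr //; apply: le_ereal_inf_tmp => _ [z Dz <-].
rewrite leeBlDr // -EFinD; apply: (le_trans (dist_set_le x Dz)).
by rewrite lee_fin [leRHS]addrC; exact: ler_distD.
Qed.

Lemma dist_set_lt_fin D x : D !=set0 -> (dist_set D x < +oo)%E.
Proof. by move=> [y Dy]; exact: (le_lt_trans (dist_set_le x Dy) (ltry _)). Qed.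

Lemma dist_set_fin_num D x : D !=set0 -> dist_set D x \is a fin_num.
Proof. by move=> D0; rewrite ge0_fin_numE ?dist_set_ge0 ?dist_set_lt_fin. Qed.

Lemma dist_set0 D x : D x -> dist_set D x = 0%E.
Proof.
move=> Dx; apply/eqP; rewrite eq_le dist_set_ge0 andbT.
by have := dist_set_le x Dx; rewrite subrr normr0.
Qed.

(** Supplies a real radius even when the distance is [+oo]. *)
Lemma dist_set_gt D x r : (r%:E < dist_set D x)%E ->
  exists2 s, r < s & (s%:E <= dist_set D x)%E.
Proof.
case: (dist_set D x) => [s||//]; last by exists (r + 1); rewrite ?ltrDl ?leey.
by rewrite lte_fin => rs; exists s.
Qed.

Lemma dist_setC_gt0P D x : (0 < dist_set (~` D) x)%E <-> D° x.
Proof.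
split=> [/dist_set_gt[r r0 /dist_set_geP rD]|].
  apply/nbhs_ballP; exists r => //= y; rewrite -ball_normE /= => xyr.
  by apply: contrapT => /rD; rewrite leNgt xyr.
move=> /nbhs_ballP[r /= r0 rD]; apply: (@lt_le_trans _ _ r%:E); rewrite ?lte_fin//.
apply/dist_set_geP => y /= Dy; rewrite leNgt; apply/negP => xyr.
by apply: Dy; apply: rD; rewrite -ball_normE.
Qed.

(** Inside [D] the distance to [D] vanishes; outside, the distance to the complement vanishes and
    neither side can exceed [r >= 0]. Nonemptiness of [D] keeps the difference well defined. *)
Lemma oriented_dist_ltN D x r : D !=set0 -> 0 <= r ->
  (r%:E < - oriented_dist D x)%E <-> (r%:E < dist_set (~` D) x)%E.
Proof.
move=> D0 r0; rewrite /oriented_dist addeC fin_num_oppeD ?dist_set_fin_num// oppeK.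
split=> [|rD].
  by move/lt_le_trans; apply; rewrite leeBlDr ?dist_set_fin_num// leeDl ?dist_set_ge0.
have Dx : D x.
  apply: contrapT => Dx; move: rD.
  by rewrite (dist_set0 (D := ~` D)) // lte_fin ltNge r0.
by rewrite (dist_set0 Dx) sube0.
Qed.

End dist_set.

(** * Depth of a point inside a convex cone *)

Section cone.
Context (R : realType) (V : normedModType R) (C : set V).
Hypotheses (C_convex : convex_set C) (C_cone : cone C).

Lemma convex_coneD u v : C u -> C v -> C (u + v).
Proof.
move=> Cu Cv.
have h0 : 0 <= 2^-1 :> R by rewrite invr_ge0.
have h1 : 2^-1 <= 1 :> R by rewrite invf_le1 // ler1n.
have := C_convex (Itv01 h0 h1) (mem_set Cu) (mem_set Cv).
rewrite inE => /(C_cone (ler0n R 2)).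
rewrite [conv _ _ _](_ : _ = 2^-1 *: (u + v)); last first.
  by rewrite scalerDr; congr (_ + _ *: _); rewrite /= /unstable.onem; lra.
by rewrite scalerA divff // scale1r.
Qed.

(** A ball around [y] inside [C], scaled by [s] and translated by [c], remains inside [C]. *)
Lemma dist_setC_scale c y (s r : R) : C c -> 0 < s ->
  (r%:E <= dist_set (~` C) y)%E -> ((s * r)%R%:E <= dist_set (~` C) (c + s *: y)%R)%E.
Proof.
move=> Cc s0 /dist_set_geP ry; apply/dist_set_geP => z /= Cz.
rewrite leNgt; apply/negP => zsr.
have : C (s^-1 *: (z - c)).
  apply: contrapT => /ry; rewrite leNgt => /negP; apply.
  rewrite -(ltr_pM2l s0) -{1}(gtr0_norm s0) -normrZ scalerBr scalerA divff ?gt_eqF//.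
  by rewrite scale1r opprB addrA [s *: y + c]addrC.
move=> /(C_cone (ltW s0)); rewrite scalerA divff ?gt_eqF// scale1r.
by move=> /convex_coneD/(_ Cc); rewrite subrK.
Qed.

Lemma dist_setC_superadd u v (s t : R) : 0 < s -> 0 < t ->
  (s%:E <= dist_set (~` C) u)%E -> (t%:E <= dist_set (~` C) v)%E ->
  ((s + t)%R%:E <= dist_set (~` C) (u + v)%R)%E.
Proof.
move=> s0 t0 /dist_set_geP su /dist_set_geP tv; apply/dist_set_geP => z /= Cz.
rewrite leNgt; apply/negP => zst; apply: Cz.
(* The displacement from [u + v] to [z] is shared between [u] and [v] in the ratio [s : t], so each
   part stays within its own ball. *)
pose w := (s + t)^-1 *: (u + v - z).
have st0 : 0 < s + t by rewrite addr_gt0.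
have w1 : `|w| < 1.
  by rewrite normrZ gtr0_norm ?invr_gt0// ltr_pdivrMl // mulr1.
rewrite (_ : z = (u - s *: w) + (v - t *: w)); last first.
  by rewrite addrACA -opprD -scalerDl scalerA divff ?gt_eqF// scale1r opprB addrC subrK.
apply: convex_coneD; apply: contrapT; [move=> /su|move=> /tv].
  by rewrite opprB addrC subrK normrZ gtr0_norm // leNgt gtr_pMr // w1.
by rewrite opprB addrC subrK normrZ gtr0_norm // leNgt gtr_pMr // w1.
Qed.

End cone.

(** * Lipschitz bounds *)

Lemma continuous_linear_norm (R : realType) (X Y : normedModType R)
    (F : {linear X -> Y}) : continuous F ->
  exists2 L : R, 0 < L & forall x, `|F x| <= L * `|x|.
Proof.
move=> F_cont; have := continuous_linear_bounded 0 (F_cont 0).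
move=> /linear_boundedP[M [_ FM]].
(* The bound holds for constants strictly above [M], and a positive one is wanted. *)
exists (Num.max M 0 + 1) => [|x]; first by rewrite ltr_wpDl// le_max lexx orbT.
by apply: FM; rewrite ltr_pwDr// le_max lexx.
Qed.

Lemma lipschitz_continuous (R : realType) (V : normedModType R) (f : V -> R)
    (L : R) : 0 < L -> (forall x y, f x <= f y + L * `|x - y|) -> continuous f.
Proof.
move=> L0 fL x; apply/cvgrPdist_lt => e e0.
apply/nbhs_ballP; exists (e / L) => [|y]; first by rewrite /= divr_gt0.
rewrite -ball_normE /= ltr_pdivlMr// mulrC => xye.
apply: le_lt_trans xye; rewrite ler_norml.
by have := fL x y; have := fL y x; rewrite distrC; lra.
Qed.

(** * The truncated merit function and its comparison with the distance to [hatA] *)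

Section merit.
Context (R : realType) (X Y : normedModType R).
Context (A : set X) (C : set Y) (F : {linear X -> Y}).

Local Notation merit := (merit A C F).
Local Notation weakly_efficient := (weakly_efficient A C F).
Local Notation hatA := (hatA A C F).

(* The truncation [max(theta, 0)], which agrees with [theta] on [A]. *)
Definition pmerit (x : X) : R := fine (maxe (merit x) 0).

Hypotheses (A_neq0 : A !=set0) (C_convex : convex_set C) (C_cone : cone C).
Hypotheses (C_int : C° !=set0) (F_cont : continuous F).
Hypotheses (F_int : (range F `&` C°) !=set0).
Hypotheses (merit_fin : forall x : X, (merit x < +oo)%E).

Let C_neq0 : C !=set0.
Proof. by case: C_int => y /interior_subset Cy; exists y. Qed.

Let C0 : C 0.
Proof. by case: C_neq0 => c /(C_cone (lexx 0)); rewrite scale0r. Qed.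

Lemma pmeritE x : (pmerit x)%:E = maxe (merit x) 0.
Proof.
rewrite /pmerit fineK // ge0_fin_numE ?le_max ?lexx ?orbT//.
by rewrite gt_max merit_fin ltry.
Qed.

Lemma pmerit_ge0 x : 0 <= pmerit x.
Proof. by rewrite -lee_fin pmeritE le_max lexx orbT. Qed.

(** The choice [a = x] contributes a nonnegative term to the supremum, since [0] lies in [C]. *)
Lemma merit_pmerit x : A x -> merit x = (pmerit x)%:E.
Proof.
move=> Ax; rewrite pmeritE max_l//; apply: ereal_sup_ge.
exists (- oriented_dist C (F x - F x)%R)%E; first by exists x.
by rewrite subrr /oriented_dist (dist_set0 C0) sub0e oppeK dist_set_ge0.
Qed.

(** At nonnegative thresholds neither the truncation nor the distance to [C] matters, so only depths
    inside [C] remain. *)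
Lemma lt_pmeritP x t : 0 <= t ->
  t < pmerit x <-> exists2 a, A a & (t%:E < dist_set (~` C) (F x - F a)%R)%E.
Proof.
move=> t0; rewrite -lte_fin pmeritE lt_max.
have -> : (t%:E < 0)%E = false by apply/negbTE; rewrite -leNgt lee_fin.
rewrite orbF.
split=> [/ereal_sup_gt[_ [a Aa <-]]|[a Aa]].
  by move/(oriented_dist_ltN _ C_neq0 t0); exists a.
move/(oriented_dist_ltN _ C_neq0 t0) => /lt_le_trans; apply.
by apply: ereal_sup_ubound; exists a.
Qed.

Lemma le_pmerit x a t : A a -> (t%:E <= dist_set (~` C) (F x - F a)%R)%E ->
  t <= pmerit x.
Proof.
move=> Aa td; rewrite leNgt; apply/negP => xt.
suff : pmerit x < pmerit x by rewrite ltxx.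
apply/lt_pmeritP; first exact: pmerit_ge0.
by exists a => //; apply: lt_le_trans td.
Qed.

Lemma pmerit_lipschitz (L : R) : 0 <= L -> (forall x, `|F x| <= L * `|x|) ->
  forall x y, pmerit x <= pmerit y + L * `|x - y|.
Proof.
move=> L0 FL x y; rewrite leNgt; apply/negP => /lt_pmeritP[].
  by rewrite addr_ge0 ?pmerit_ge0 ?mulr_ge0.
move=> a Aa; rewrite ltNge => /negP; apply.
apply: (le_trans (dist_set_triangle _ _ (F y - F a))).
rewrite EFinD leeD//; last first.
  by rewrite lee_fin opprB addrA subrK -linearB.
rewrite leNgt; apply/negP => pd.
suff : pmerit y < pmerit y by rewrite ltxx.
by apply/lt_pmeritP; [exact: pmerit_ge0|exists a].
Qed.

(** By continuity, points mapped into the interior of [C] are interior to the preimage. Conversely,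
    an interior [p] can be moved back along [k] within the preimage, and adding [r *: F k] again
    makes [F p] interior to [C]. *)
Lemma hatA_pmerit x : hatA x <-> pmerit x <= 0.
Proof.
have [_ [[k _ <-] Ck]] := F_int.
split=> [hx|px [a Aa [p pC apx]]].
  rewrite leNgt; apply/negP => /lt_pmeritP -/(_ (lexx 0))[a Aa /dist_setC_gt0P CF].
  apply: hx; exists a => //; exists (x - a); last by rewrite addrC subrK.
  by apply: F_cont; rewrite linearB.
have [r r0 rC] : exists2 r, 0 < r & C (F (p - r *: k)).
  move/nbhs_ballP: pC => [e /= e0 eC].
  exists (e / (1 + `|k|)); first by rewrite divr_gt0 // ltr_wpDr.
  apply: eC; rewrite -ball_normE /= opprB addrC subrK normrZ.
  rewrite gtr0_norm ?divr_gt0 ?ltr_wpDr//.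
  by rewrite mulrAC ltr_pdivrMr ?ltr_wpDr// ltr_pM2l// ltrDr.
have [rho rho0 rhok] := dist_set_gt ((dist_setC_gt0P _ _).2 Ck).
have := dist_setC_scale C_convex C_cone rC r0 rhok.
rewrite -linearZ -linearD subrK.
have -> : F p = F x - F a by rewrite -linearB -apx addrC addKr.
move=> /(le_pmerit Aa); rewrite leNgt => /negP; apply.
by apply: (le_lt_trans px); rewrite mulr_gt0.
Qed.

Lemma weakly_efficient_pmerit x : weakly_efficient x <-> A x /\ pmerit x <= 0.
Proof.
split=> -[Ax h]; split=> //.
  rewrite leNgt; apply/negP => /lt_pmeritP -/(_ (lexx 0))[a Aa /dist_setC_gt0P CF].
  by apply: h; exists (F a); [exists a|exists (F x - F a); rewrite // addrC subrK].
move=> [_ [a Aa <-] [c Cc acx]].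
move: h; rewrite leNgt => /negP; apply; apply/lt_pmeritP => //.
by exists a => //; apply/dist_setC_gt0P; rewrite -acx addrC addKr.
Qed.

Lemma weakly_efficientE : weakly_efficient = A `&` hatA.
Proof.
apply/seteqP; split=> x; first by move/weakly_efficient_pmerit => -[Ax /hatA_pmerit].
by move=> [Ax /hatA_pmerit h]; apply/weakly_efficient_pmerit.
Qed.

Lemma pmerit_le_dist_hatA (L : R) : 0 < L -> (forall x, `|F x| <= L * `|x|) ->
  forall x, ((pmerit x)%:E <= L%:E * dist_set hatA x)%E.
Proof.
move=> L0 FL x; rewrite muleC -lee_pdivrMr//.
apply/dist_set_geP => y /hatA_pmerit y0; rewrite ler_pdivrMr// mulrC.
have := pmerit_lipschitz (ltW L0) FL x y; lra.
Qed.

Lemma dist_hatA_le_pmerit : exists2 K : R, 0 < K &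
  forall x, (dist_set hatA x <= (K * pmerit x)%:E)%E.
Proof.
have [_ [[k _ <-] Ck]] := F_int.
have [rho rho0 rhok] := dist_set_gt ((dist_setC_gt0P _ _).2 Ck).
have k0 : 0 < 1 + `|k| by rewrite ltr_wpDr.
exists ((1 + `|k|) / rho) => [|x]; first by rewrite divr_gt0.
rewrite leNgt; apply/negP => /dist_set_gt[r xr /dist_set_geP rhat].
have r0 : 0 < r by apply: le_lt_trans xr; rewrite !mulr_ge0 ?invr_ge0 ?pmerit_ge0 ?ltW.
(* This length keeps [e *: k] shorter than [r], so [x - e *: k] misses [hatA], while the choice of
   constant makes the gained depth [e * rho] exceed [pmerit x]. *)
pose e := r / (1 + `|k|).
have e0 : 0 < e by rewrite divr_gt0.
have : ~ hatA (x - e *: k).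
  move=> /rhat; rewrite opprB addrC subrK normrZ gtr0_norm// leNgt => /negP; apply.
  by rewrite mulrAC ltr_pdivrMr// ltr_pM2l// ltrDr.
move=> /contrapT[a Aa [p /interior_subset pC apx]].
have := dist_setC_scale C_convex C_cone pC e0 rhok.
rewrite -linearZ -linearD.
have -> : F (p + e *: k) = F x - F a.
  by rewrite -linearB; congr (F _); rewrite -[x](subrK (e *: k)) -apx -(addrA a) [RHS]addrC addKr.
move=> /(le_pmerit Aa); rewrite leNgt => /negP; apply.
by rewrite /e mulrAC ltr_pdivlMr// mulrC; move: xr; rewrite mulrAC ltr_pdivrMr.
Qed.

Lemma exists_pmerit_le (e : R) : 0 < e -> exists2 a, A a & pmerit a <= e.
Proof.
move=> e0; have [x Ax] := A_neq0.
have [xe|ex] := leP (pmerit x) e; first by exists x.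
(* If [pmerit a] exceeded [e], superadditivity would exceed [pmerit x]. *)
have [a Aa xa] : exists2 a, A a &
    ((pmerit x - e)%:E < dist_set (~` C) (F x - F a)%R)%E.
  by apply/lt_pmeritP; lra.
exists a => //; rewrite leNgt; apply/negP => /lt_pmeritP -/(_ (ltW e0))[b Ab ab].
have h0 : 0 < pmerit x - e by lra.
have [s xs sF] := dist_set_gt xa.
have := dist_setC_superadd C_convex C_cone (lt_trans h0 xs) e0 sF (ltW ab).
rewrite addrA subrK => /(le_pmerit Ab); lra.
Qed.

End merit.

(** * Distance estimates equivalent to the error bound *)

Section error_bounds.
Context (R : realType) (X Y : completeNormedModType R).
Context (A : set X) (C : set Y) (F : {linear X -> Y}).

Local Notation merit := (merit A C F).
Local Notation E := (weakly_efficient A C F).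
Local Notation hatA := (hatA A C F).
Local Notation m := (pmerit A C F).

Hypotheses (A_neq0 : A !=set0) (A_closed : closed A).
Hypotheses (C_convex : convex_set C) (C_cone : cone C).
Hypotheses (C_int : C° !=set0) (F_cont : continuous F).
Hypotheses (F_int : (range F `&` C°) !=set0).
Hypotheses (merit_fin : forall x : X, (merit x < +oo)%E).

Let m_ge0 x : 0 <= m x. Proof. exact: pmerit_ge0. Qed.
Let meritE x : A x -> merit x = (m x)%:E. Proof. exact: merit_pmerit. Qed.
Let effP x : E x <-> A x /\ m x <= 0. Proof. exact: weakly_efficient_pmerit. Qed.

Let eff_sub x : E x -> A x. Proof. by move/effP => []. Qed.
Let eff0 x : E x -> m x = 0.
Proof. by move/effP => [_ mx]; apply/eqP; rewrite eq_le mx m_ge0. Qed.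
Let noneff x : A x -> ~ E x -> 0 < m x.
Proof. by move=> Ax Ex; rewrite ltNge; apply/negP => mx; exact/Ex/effP. Qed.

Let m_lipschitz :
  exists2 L, 0 < L & forall x y, m x <= m y + L * `|x - y|.
Proof.
have [L L0 FL] := continuous_linear_norm F_cont.
by exists L => // x y; exact: pmerit_lipschitz (ltW L0) FL x y.
Qed.

Let m_continuous : continuous m.
Proof. by have [L L0 mL] := m_lipschitz; exact: lipschitz_continuous L0 mL. Qed.

(** The distance to [E] need not be attained. Off [E] the merit is positive, so doubling the
    constant gives a strict inequality and hence an actual point. *)
Lemma merit_error_boundP : merit_error_bound A C F <->
  exists2 c : R, 0 < c & forall x, A x -> exists2 y, E y & `|x - y| <= c * m x.
Proof.
split=> -[c c0 h].
  exists (2 * c) => [|x Ax]; first by rewrite mulr_gt0.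
  have [Ex|/(noneff Ax) mx] := pselect (E x).
    by exists x; rewrite // subrr normr0 eff0// mulr0.
  have [y Ey xy] : exists2 y, E y & `|x - y| < 2 * c * m x.
    apply/dist_set_ltP; apply: (le_lt_trans (h x Ax)).
    by rewrite meritE// -EFinM lte_fin -mulrA ltr_pMl ?mulr_gt0// ltr1n.
  by exists y => //; exact: ltW.
exists c => // x Ax; have [y Ey xy] := h x Ax.
by rewrite meritE// (le_trans (dist_set_le x Ey)).
Qed.

(** Common source of the perturbed, [zeta] and ambient bounds, obtained by passing through an
    arbitrary [a] of [A]; the added [1] absorbs the coefficient of [|x - a|]. *)
Lemma merit_error_bound_through : merit_error_bound A C F ->
  exists2 tau, 0 < tau & forall x a, A a ->
    (dist_set E x <= (tau * (m a + `|x - a|))%:E)%E.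
Proof.
move=> [tau tau0 h]; exists (tau + 1) => [|x a Aa]; first by rewrite addr_gt0.
apply: (le_trans (dist_set_triangle _ _ a)).
apply: (le_trans (leeD2r _ (h a Aa))); rewrite meritE// -EFinM -EFinD lee_fin.
by have := m_ge0 a; have := normr_ge0 (x - a); have := tau0; nra.
Qed.

Lemma merit_error_bound_perturbed :
  merit_error_bound A C F -> perturbed_error_bound A C F.
Proof.
move=> /merit_error_bound_through[tau tau0 h]; exists tau => // x e Ax.
by have := h (x + e) x Ax; rewrite (addrC x e) addrK meritE.
Qed.

Lemma perturbed_error_bound_merit :
  perturbed_error_bound A C F -> merit_error_bound A C F.
Proof.
move=> [k k0 h]; exists k => // x Ax.
by have := h x 0 Ax; rewrite addr0 normr0 adde0.
Qed.

Lemma merit_error_bound_zeta :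
  merit_error_bound A C F -> zeta_error_bound A C F.
Proof.
move=> /merit_error_bound_through[tau tau0 h]; exists tau => // x.
rewrite muleC -lee_pdivrMr//; apply: le_ereal_inf_tmp => _ [a Aa <-].
by rewrite lee_pdivrMr// muleC meritE// -EFinD -EFinM; exact: h.
Qed.

Lemma zeta_error_bound_merit :
  zeta_error_bound A C F -> merit_error_bound A C F.
Proof.
move=> [k k0 h]; exists k => // x Ax; apply: (le_trans (h x)).
rewrite lee_pmul2l//; apply: ereal_inf_lbound; exists x => //.
by rewrite subrr normr0 adde0.
Qed.

Lemma merit_error_bound_ambient :
  merit_error_bound A C F -> ambient_error_bound A C F.
Proof.
move=> /merit_error_bound_through[tau tau0 h].
have [L L0 mL] := m_lipschitz.
pose g := tau * (1 + L).
have g0 : 0 < g by rewrite mulr_gt0// addr_gt0.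
(* Isolating [dist_set A x] allows a test against each [a] in [A]; the factor [1 + L] pays for
   replacing [m a] by [m x]. *)
exists g => // x; rewrite -pmeritE// muleC -lee_pdivrMr// addeC -leeBlDr//.
apply: le_ereal_inf_tmp => _ [a Aa <-].
rewrite leeBlDr// -EFinD lee_pdivrMr// -EFinM; apply: (le_trans (h x a Aa)).
rewrite lee_fin /g mulrCA ler_pM2l//.
have := mL a x; rewrite distrC => max.
have := mulr_ge0 (ltW L0) (m_ge0 x); nra.
Qed.

Lemma ambient_error_bound_regularity :
  ambient_error_bound A C F -> linear_regularity A C F.
Proof.
move=> [g g0 h]; have [L L0 FL] := continuous_linear_norm F_cont.
(* The truncated merit costs [L] times the distance to [hatA], the other term one distance to [A];
   both are below the maximum. *)
exists (g * (L + 1)) => [|x]; first by rewrite mulr_gt0// addr_gt0.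
rewrite -weakly_efficientE//; apply: (le_trans (h x)).
rewrite EFinM -muleA lee_pmul2l// EFinD ge0_muleDl ?lee_fin ?(ltW L0)// mul1e.
apply: leeD; last by rewrite le_max lexx.
rewrite -pmeritE//; apply: (le_trans (pmerit_le_dist_hatA _ _ _ _ _ _ L0 FL x)) => //.
by rewrite lee_pmul2l// le_max lexx orbT.
Qed.

Lemma linear_regularity_hatA :
  linear_regularity A C F -> hatA_error_bound A C F.
Proof.
move=> [k k0 h]; exists k => // x Ax; rewrite weakly_efficientE//.
apply: (le_trans (h x)); rewrite lee_pmul2l// dist_set0//.
by rewrite ge_max lexx dist_set_ge0.
Qed.

Lemma hatA_error_bound_merit :
  hatA_error_bound A C F -> merit_error_bound A C F.
Proof.
move=> [tau tau0 h].
have [K K0 hK] := dist_hatA_le_pmerit C_convex C_cone C_int F_int merit_fin.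
exists (tau * K) => [|x Ax]; first by rewrite mulr_gt0.
by apply: (le_trans (h x Ax)); rewrite EFinM -muleA lee_pmul2l// meritE.
Qed.

Lemma merit_error_bound_hatA :
  merit_error_bound A C F -> hatA_error_bound A C F.
Proof.
by move=> /merit_error_bound_ambient/ambient_error_bound_regularity/linear_regularity_hatA.
Qed.

(** * Contraction, decrease and slope conditions *)

Lemma merit_error_bound_contraction :
  merit_error_bound A C F -> merit_contraction A C F.
Proof.
(* Any ratio in [(0, 1)] would do, since the merit vanishes at the chosen [y]. *)
move=> /merit_error_boundP[c c0 h]; exists c, 2^-1; split=> //.
  by apply/andP; split; lra.
move=> x Ax; have [y Ey xy] := h x Ax; exists y.
have Ay := eff_sub Ey; rewrite !meritE// (eff0 Ey) -!EFinM !lee_fin.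
by split=> //; rewrite mulr_ge0.
Qed.

Lemma merit_contraction_decrease :
  merit_contraction A C F -> merit_decrease A C F.
Proof.
move=> [al [be [al0 /andP[be0 be1] h]]].
(* The drop in merit is at least [(1 - be) * m x], and [m x] is at least [|x - y| / al]. *)
exists ((1 - be) / al) => [|x [Ax Ex]]; first by rewrite divr_gt0// subr_gt0.
have [y []] := h x Ax => Ay; rewrite !meritE// -!EFinM !lee_fin => xy myx.
exists y; rewrite !meritE// -EFinM -EFinB lee_fin; split=> //.
  move=> yx; move: myx; rewrite yx leNgt => /negP; apply.
  by rewrite gtr_pMl// noneff.
rewrite lerBrDl -lerBrDr mulrAC ler_pdivrMr//.
have := noneff Ax Ex; nra.
Qed.

(** Descent along the merit by [caristi], with [E] as target, ends within [m x / c] of [x]. *)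
Lemma merit_decrease_error_bound :
  merit_decrease A C F -> merit_error_bound A C F.
Proof.
move=> [c c0 h]; apply/merit_error_boundP; exists c^-1; rewrite ?invr_gt0// => x Ax.
have [z Az Ez|y [Ay Ey xy]] := @caristi R X A E m c A_closed m_continuous (fun x _ => m_ge0 x) c0 _ x Ax.
  have [y [Ay yz]] := h z (conj Az Ez).
  by rewrite !meritE// -EFinM -EFinB lee_fin => myz; exists y; split=> //; lra.
by exists y => //; rewrite ler_pdivlMl.
Qed.

Lemma merit_decrease_slope :
  merit_decrease A C F -> merit_slope_bound A C F.
Proof.
move=> [c c0 h]; exists c => // x AEx; have [y [Ay yx myx]] := h x AEx.
have [Ax _] := AEx.
have xy0 : 0 < `|x - y| by rewrite normr_gt0 subr_eq0 eq_sym; apply/eqP.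
have {}myx : m y <= m x - c * `|x - y|.
  by move: myx; rewrite !meritE// -EFinM -EFinB lee_fin.
rewrite /merit_slope le_max; apply/orP; right; apply: ereal_sup_ge.
exists ((merit x - merit y) / `|x - y|%:E)%E.
  exists y => //; split=> //; rewrite !meritE// lte_fin.
  by have := mulr_gt0 c0 xy0; lra.
rewrite !meritE// -EFinB inver gt_eqF// -EFinM lee_fin ler_pdivlMr//; lra.
Qed.

Lemma merit_slope_decrease :
  merit_slope_bound A C F -> merit_decrease A C F.
Proof.
(* Halving makes room for a supremum that is not attained; positivity rules out the branch [0] of
   the maximum. *)
move=> [g g0 h]; exists (g / 2) => [|x AEx]; first by rewrite divr_gt0.
have [Ax _] := AEx.
have : ((g / 2)%:E < merit_slope A C F x)%E.
  by apply: lt_le_trans (h x AEx); rewrite lte_fin; lra.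
have g2 : ((g / 2)%:E < 0)%E = false.
  by apply/negbTE; rewrite -leNgt lee_fin divr_ge0// ltW.
rewrite /merit_slope lt_max g2 orFb.
move=> /ereal_sup_gt[_ [y [Ay mxy] <-]] gxy.
have {}mxy : m y < m x by move: mxy; rewrite !meritE.
have yx : y <> x by move=> yx; move: mxy; rewrite yx ltxx.
have xy0 : 0 < `|x - y| by rewrite normr_gt0 subr_eq0 eq_sym; apply/eqP.
have {}gxy : g / 2 * `|x - y| < m x - m y.
  move: gxy; rewrite !meritE// -EFinB inver gt_eqF// -EFinM lte_fin.
  by rewrite ltr_pdivlMr.
by exists y; split=> //; rewrite !meritE// -EFinM -EFinB lee_fin; lra.
Qed.

Lemma merit_error_bound_tfae :
  [<-> merit_error_bound A C F; linear_regularity A C F;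
       hatA_error_bound A C F; merit_contraction A C F;
       perturbed_error_bound A C F; ambient_error_bound A C F;
       zeta_error_bound A C F; merit_decrease A C F; merit_slope_bound A C F].
Proof.
tfae.
- by move=> /merit_error_bound_ambient/ambient_error_bound_regularity.
- exact: linear_regularity_hatA.
- by move=> /hatA_error_bound_merit/merit_error_bound_contraction.
- move=> /merit_contraction_decrease/merit_decrease_error_bound.
  exact: merit_error_bound_perturbed.
- by move=> /perturbed_error_bound_merit/merit_error_bound_ambient.
- move=> /ambient_error_bound_regularity/linear_regularity_hatA.
  by move=> /hatA_error_bound_merit/merit_error_bound_zeta.
- move=> /zeta_error_bound_merit/merit_error_bound_contraction.
  exact: merit_contraction_decrease.
- exact: merit_decrease_slope.
- by move=> /merit_slope_decrease/merit_decrease_error_bound.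
Qed.

(** * One-way consequences, and the converse for images *)

Lemma merit_error_bound_image :
  merit_error_bound A C F -> image_error_bound A C F.
Proof.
move=> /merit_error_boundP[c c0 h]; have [L L0 FL] := continuous_linear_norm F_cont.
exists (L * c) => [|x Ax]; first by rewrite mulr_gt0.
have [y Ey xy] := h x Ax.
have Fy : wmin (F @` A) C (F y) by case: Ey => Ay; split=> //; exists y.
apply: (le_trans (dist_set_le _ Fy)); rewrite meritE// -EFinM lee_fin -linearB.
by apply: (le_trans (FL _)); rewrite -mulrA ler_pM2l.
Qed.

Lemma image_error_bound_merit (mu : R) : 0 < mu ->
  (forall z, set_sub A A z -> mu * `|z| <= `|F z|) ->
  image_error_bound A C F -> merit_error_bound A C F.
Proof.
move=> mu0 Fmu [c c0 h]; exists (mu^-1 * c) => [|x Ax].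
  by rewrite mulr_gt0 ?invr_gt0.
apply/lee_addgt0Pr => e e0.
(* The slack [mu * e] becomes [e] once the lower bound on [F] over [A - A] pulls the estimate back
   to [X]. *)
have : (dist_set (wmin (F @` A) C) (F x) < (c * m x + mu * e)%:E)%E.
  apply: (le_lt_trans (h x Ax)); rewrite meritE// -EFinM lte_fin.
  by rewrite ltrDl mulr_gt0.
move=> /dist_set_ltP[_ [[y Ay <-] Fy] Fxy].
have Ey : E y by [].
apply: (le_trans (dist_set_le x Ey)); rewrite meritE// -EFinM -EFinD lee_fin.
rewrite -mulrA -(ler_pM2l mu0) mulrDr mulVKf ?gt_eqF//.
apply: le_trans (ltW Fxy); rewrite -linearB; apply: Fmu.
by exists x => //; exists y.
Qed.

Lemma hatA_error_bound_liminf :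
  hatA_error_bound A C F -> positive_liminf_ratio A C F.
Proof.
move=> [tau tau0 h]; have [L L0 mL] := m_lipschitz.
rewrite /positive_liminf_ratio limf_einfE.
apply: (@lt_le_trans _ _ (tau^-1)%:E); first by rewrite lte_fin invr_gt0.
apply: ereal_sup_ge.
exists (ereal_inf ((fun x => dist_set hatA x / dist_set E x)%E @` (A `\` E))).
  (* The ratio is at least [tau^-1] on all of [A] outside [E], so the radius [1] is arbitrary. *)
  by exists (A `\` E) => //; exists 1 => //= x _.
apply: le_ereal_inf_tmp => _ [x [Ax Ex] <-].
(* The merit is positive at [x], zero on [E] and Lipschitz, so the quotient has a positive
   denominator. *)
have dE0 : (0 < dist_set E x)%E.
  apply: (@lt_le_trans _ _ (m x / L)%:E).
    by rewrite lte_fin divr_gt0 ?noneff.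
  apply/dist_set_geP => y Ey; rewrite ler_pdivrMr// mulrC.
  by have := mL x y; rewrite (eff0 Ey) add0r.
have := h x Ax; have dA0 := dist_set_ge0 hatA x.
have [K K0 hK] := dist_hatA_le_pmerit C_convex C_cone C_int F_int merit_fin.
have : (dist_set hatA x < +oo)%E by apply: le_lt_trans (hK x) (ltry _).
case: (dist_set hatA x) dA0 => [a||]// a0 _.
case: (dist_set E x) dE0 => [b||]//; rewrite lte_fin => b0.
rewrite -EFinM lee_fin => ba.
by rewrite inver gt_eqF// -EFinM lee_fin ler_pdivlMr// ler_pdivrMl.
Qed.

(** The excess of [Phi t] over [E] is the error bound on a sublevel set; the other excess vanishes
    because [E] lies in every [Phi t] with [t >= 0]. *)
Lemma merit_error_bound_Phi_hausdorff :
  merit_error_bound A C F -> Phi_hausdorff_calm A C F.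
Proof.
move=> [tau tau0 h]; exists 1, tau; split=> // t /andP[t0 _].
rewrite /hausdorff_dist ge_max; apply/andP; split; apply: ge_ereal_sup => _ [x + <-].
  move=> [Ax mt]; apply: (le_trans (h x Ax)).
  by rewrite EFinM lee_pmul2l.
move=> Ex; have Ax := eff_sub Ex.
rewrite dist_set0 ?lee_fin ?mulr_ge0 ?(ltW tau0)//; split=> //.
by rewrite meritE// eff0// lee_fin.
Qed.

Let Phi0 : Phi A C F 0 = E.
Proof.
apply/seteqP; split=> x; first by move=> [Ax]; rewrite meritE// lee_fin => mx; exact/effP.
by move/effP => [Ax mx]; split=> //; rewrite meritE.
Qed.

(** For [x] in [A], [Phi_inv x] is the half-line of reals from [m x] upwards. *)
Let dist_Phi_inv x : A x -> dist_set (Phi_inv A C F x) 0 = (m x)%:E.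
Proof.
move=> Ax; apply/eqP; rewrite eq_le; apply/andP; split.
  apply: (@le_trans _ _ `|0 - m x|%:E); last by rewrite sub0r normrN ger0_norm.
  by apply: dist_set_le; split=> //; split=> //; rewrite meritE.
apply/dist_set_geP => t [t0 [_]]; rewrite meritE// lee_fin sub0r normrN.
by rewrite ger0_norm.
Qed.

Lemma merit_error_bound_Phi_subregular :
  merit_error_bound A C F -> Phi_metric_subregular A C F.
Proof.
move=> [tau tau0 h]; exists tau, setT; split=> //; first exact: openT.
by move=> x [_ Ax]; rewrite Phi0 dist_Phi_inv// -meritE//; exact: h.
Qed.

(** * Converses for bounded or compact [A] *)

(** Where the merit is at least [delta], the distance to [E] is at most the diameter bound [2 * D],
    hence at most [2 * D / delta] times the merit. *)
Lemma merit_error_bound_local (tau delta : R) : bounded_set A -> E !=set0 ->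
  0 < tau -> 0 < delta ->
  (forall x, A x -> m x < delta -> (dist_set E x <= (tau * m x)%:E)%E) ->
  merit_error_bound A C F.
Proof.
move=> [M [_ AM]] [z Ez] tau0 delta0 h.
have {}AM x : A x -> `|x| <= Num.max M 0 + 1.
  by apply: AM; rewrite ltr_pwDr// le_max lexx.
set D := _ + 1 in AM; have D0 : 0 < D by rewrite ltr_wpDl// le_max lexx orbT.
exists (tau + (2 * D) / delta) => [|x Ax]; first by rewrite addr_gt0 ?divr_gt0 ?mulr_gt0.
rewrite meritE//; have [mx|mx] := ltP (m x) delta.
  apply: (le_trans (h x Ax mx)); rewrite lee_fin ler_wpM2r//.
  by rewrite lerDl divr_ge0 ?mulr_ge0 ?ltW.
apply: (le_trans (dist_set_le x Ez)); rewrite lee_fin.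
apply: (@le_trans _ _ (2 * D)).
  apply: (le_trans (ler_normB _ _)).
  by have := AM x Ax; have := AM z (eff_sub Ez); lra.
apply: (@le_trans _ _ ((2 * D) / delta * m x)).
  by rewrite mulrAC ler_pdivlMr// ler_pM2l// mulr_gt0.
by rewrite ler_wpM2r// lerDr ltW.
Qed.

Lemma Phi_hausdorff_merit_error_bound : bounded_set A ->
  Phi_hausdorff_calm A C F -> merit_error_bound A C F.
Proof.
move=> bA [t0 [beta [t00 beta0 h]]].
have hdist t x : 0 <= t <= t0 -> A x -> m x <= t ->
    (dist_set E x <= (beta * t)%:E)%E.
  move=> tt0 Ax mt; apply: le_trans (h t tt0).
  rewrite le_max; apply/orP; left; apply: ereal_sup_ubound; exists x => //.
  by split=> //; rewrite meritE.
have [a Aa mat] := exists_pmerit_le A_neq0 C_convex C_cone C_int merit_fin t00.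
(* A point of [Phi t0] exists because the merit has infimum [0], and its finite distance to [E]
   forces [E] to be nonempty. *)
have E0 : E !=set0.
  have : (dist_set E a < (beta * t0 + 1)%:E)%E.
    by apply: le_lt_trans (hdist t0 a _ Aa mat) _; rewrite ?(ltW t00)//= lte_fin ltrDl.
  by move=> /dist_set_ltP[y Ey _]; exists y.
apply: (merit_error_bound_local bA E0 beta0 t00) => x Ax mx.
by apply: hdist => //; rewrite m_ge0 ltW.
Qed.

Lemma compact_weakly_efficient_neq0 : compact A -> E !=set0.
Proof.
move=> cA.
have [c /set_mem Ac cmin] := compact_EVT_min A_neq0 cA
  (continuous_subspaceT m_continuous).
exists c; apply/effP; split=> //; apply/ler_addgt0Pr => e e0; rewrite add0r.
have [a Aa mae] := exists_pmerit_le A_neq0 C_convex C_cone C_int merit_fin e0.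
by apply: le_trans mae; apply: cmin; rewrite inE.
Qed.

(** The merit is positive on the compact part of [A] outside [U], and [delta] is its minimum there,
    or arbitrary when that part is empty. *)
Lemma compact_merit_sublevel (U : set X) : compact A -> open U -> E `<=` U ->
  exists2 delta, 0 < delta & forall x, A x -> m x < delta -> U x.
Proof.
move=> cA oU EU; have cK : compact (A `&` ~` U).
  by apply: compact_closedI => //; exact: open_closedC.
have [K0|/set0P/negP] := pselect ((A `&` ~` U) !=set0); last first.
  rewrite negbK => /eqP K0; exists 1 => // x Ax _; apply: contrapT => Ux.
  by have : (A `&` ~` U) x by []; rewrite K0.
have [c /set_mem[Ac Uc] cmin] := compact_EVT_min K0 cK
  (continuous_subspaceT m_continuous).
exists (m c) => [|x Ax mxc]; first by apply: noneff => // /EU.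
apply: contrapT => Ux; move: mxc; rewrite ltNge => /negP; apply.
by apply: cmin; rewrite inE.
Qed.

Lemma Phi_subregular_merit_error_bound : compact A ->
  Phi_metric_subregular A C F -> merit_error_bound A C F.
Proof.
move=> cA [k [U [k0 oU EU h]]].
have [d d0 dU] := compact_merit_sublevel cA oU EU.
apply: (merit_error_bound_local (compact_bounded cA)
  (compact_weakly_efficient_neq0 cA) k0 d0) => x Ax mx.
by have := h x (conj (dU x Ax mx) Ax); rewrite Phi0 dist_Phi_inv.
Qed.

Lemma liminf_hatA_error_bound : compact A ->
  positive_liminf_ratio A C F -> hatA_error_bound A C F.
Proof.
move=> cA; rewrite /positive_liminf_ratio limf_einfE.
move=> /ereal_sup_gt[_ [V [e /= e0 eV] <-]] infV.
have [d d0 dV] : exists2 d : R, 0 < d & forall x, V x ->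
    (d%:E <= dist_set hatA x / dist_set E x)%E.
  move: infV; set i := ereal_inf _ => i0.
  have iV x : V x -> (i <= dist_set hatA x / dist_set E x)%E.
    by move=> Vx; apply: ereal_inf_lbound; exists x.
  case: i i0 iV => [d||]//; first by rewrite lte_fin => d0 iV; exists d.
  (* An infimum of [+oo], as for empty [V], allows any positive real bound. *)
  by move=> _ iV; exists 1 => // x /iV; apply: le_trans; exact: leey.
have [K K0 hK] := dist_hatA_le_pmerit C_convex C_cone C_int F_int merit_fin.
(* Small merit places a point of [A] in this open neighbourhood of [E], where the ratio bound
   applies. *)
pose U := \bigcup_(y in E) ball y e.
have [r r0 rU] : exists2 r, 0 < r & forall x, A x -> m x < r -> U x.
  apply: compact_merit_sublevel => //.
    by apply: bigcup_open => y _; exact: ball_open.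
  by move=> x Ex; exists x => //; exact: ballxx.
apply: merit_error_bound_hatA.
have Kd0 : 0 < K / d by rewrite divr_gt0.
apply: (merit_error_bound_local (compact_bounded cA)
  (compact_weakly_efficient_neq0 cA) Kd0 r0) => x Ax mx.
have [Ex|Ex] := pselect (E x).
  by rewrite dist_set0// lee_fin mulr_ge0 ?m_ge0 ?ltW.
have [y Ey] := rU x Ax mx; rewrite -ball_normE /= distrC => xy.
have xe : (dist_set E x < e%:E)%E by apply/dist_set_ltP; exists y.
have := dV x (eV x xe (conj Ax Ex)); have := hK x.
have Efin := dist_set_fin_num x (compact_weakly_efficient_neq0 cA).
have dE0 := dist_set_ge0 E x; have dA0 := dist_set_ge0 hatA x.
case: (dist_set hatA x) dA0 => [a||]//.
case: (dist_set E x) dE0 Efin => [b||]//; rewrite !lee_fin => b0 _ a0 aK.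
(* At distance zero from [E] the claim is immediate, and only otherwise is the ratio a true
   quotient. *)
move: b0; rewrite le_eqVlt => /orP[/eqP <-|b0].
  by move=> _; rewrite mulr_ge0 ?(ltW Kd0).
rewrite inver gt_eqF// -EFinM lee_fin ler_pdivlMr// => dba.
by rewrite mulrAC ler_pdivlMr// mulrC; exact: le_trans dba aK.
Qed.

End error_bounds.

Theorem theorem4p1 (R : realType) (X Y : completeNormedModType R)
  (A : set X) (C : set Y) (F : {linear X -> Y})
  (A_neq0 : A !=set0) (A_closed : closed A) (A_convex : convex_set A)
  (C_closed : closed C) (C_convex : convex_set C) (C_cone : cone C)
  (C_int : C° !=set0) (F_cont : continuous F)
  (F_int : (range F `&` C°) !=set0)
  (merit_fin : forall x : X, (merit A C F x < +oo)%E) :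
  [/\
      [<-> merit_error_bound A C F;
           linear_regularity A C F;
           hatA_error_bound A C F;
           merit_contraction A C F;
           perturbed_error_bound A C F;
           ambient_error_bound A C F;
           zeta_error_bound A C F;
           merit_decrease A C F;
           merit_slope_bound A C F]
      /\ [/\ merit_error_bound A C F -> image_error_bound A C F,
             hatA_error_bound A C F -> positive_liminf_ratio A C F,
             merit_error_bound A C F -> Phi_hausdorff_calm A C F &
             merit_error_bound A C F -> Phi_metric_subregular A C F],
      (exists2 mu : R, 0 < mu &
         forall z, set_sub A A z -> mu * `|z| <= `|F z|) ->
        image_error_bound A C F -> merit_error_bound A C F,
      bounded_set A -> Phi_hausdorff_calm A C F -> merit_error_bound A C F &
      compact A ->
        (positive_liminf_ratio A C F -> hatA_error_bound A C F) /\
        (Phi_metric_subregular A C F -> merit_error_bound A C F)].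
Proof.
split; first split; first by apply merit_error_bound_tfae.
- split; [exact: merit_error_bound_image|exact: hatA_error_bound_liminf|
    exact: merit_error_bound_Phi_hausdorff|exact: merit_error_bound_Phi_subregular].
- by move=> [mu mu0 Fmu]; exact: image_error_bound_merit mu0 Fmu.
- exact: Phi_hausdorff_merit_error_bound.
- move=> cA; split; first exact: liminf_hatA_error_bound.
  exact: Phi_subregular_merit_error_bound.
Qed.
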